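(* Let $A(t), B(t), C(t)$ be continuous complex $n\times n$ matrix-valued functions on $[t_0;+\infty)$ with $B(t)=B^*(t)$, $C(t)=C^*(t)$ for $t\ge t_0$. Suppose that: 1') $B(t)\ge 0$ for $t\ge t_0$; 2') there exists a continuously differentiable hermitian matrix-function $S(t)$ on $[t_0;+\infty)$ such that $A^*(t)+S(t)B(t)\in\Omega_n$ for all $t\ge t_0$; 3') with $\sigma_S(t)= W(A^*(t)+S(t)B(t))$ and $D_S(t)= S'(t)+S(t)B(t)S(t)+A^*(t)S(t)+S(t)A(t)-C(t)$, the scalar system $$\phi'=\sigma_S(t)\phi+\frac{\lambda(B(t))}{n}\psi,\qquad \psi'=-\operatorname{tr}(D_S(t))\phi-\sigma_S(t)\psi,\qquad t\ge t_0,$$ is oscillatory. Then the hamiltonian system $$\Phi'=A(t)\Phi+B(t)\Psi,\qquad \Psi'=C(t)\Phi-A^*(t)\Psi,\qquad t\ge t_0,$$ is also oscillatory.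
   Context: $M^*$ denotes the conjugate transpose of $M$. In the hamiltonian system $\Phi,\Psi$ are unknown continuously differentiable complex $n\times n$ matrix-functions on $[t_0;+\infty)$. A solution $(\Phi,\Psi)$ is called prepared if $\Phi^*(t)\Psi(t)=\Psi^*(t)\Phi(t)$ for $t\ge t_0$. A prepared solution is oscillatory if $\det\Phi(t)$ has arbitrarily large zeroes. The hamiltonian system is oscillatory if every prepared solution is oscillatory. A real scalar linear system in unknowns $(\phi,\psi)$ on $[t_0;+\infty)$ is oscillatory if for every (real) solution $(\phi,\psi)$ the function $\phi$ has arbitrarily large zeroes. $\Omega_n$ is the set of normal $n\times n$ matrices $M$ ($M^*M=MM^*$) all of whose eigenvalues have the same real part; this common real part is denoted $W(M)$. For a hermitian matrix $H$, $\lambda(H)$ is its least eigenvalue, and $H\ge0$ means $H$ is non-negative definite. *)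

(* Defs.v *)
From HB Require Import structures.
From mathcomp Require Import all_boot all_order all_algebra.
From mathcomp Require Import complex.
From mathcomp Require Import all_classical all_reals all_analysis.

Set Implicit Arguments.
Unset Strict Implicit.
Unset Printing Implicit Defensive.

Import Order.TTheory GRing.Theory Num.Theory.
Import numFieldNormedType.Exports.

Local Open Scope classical_set_scope.
Local Open Scope ring_scope.
Local Open Scope complex_scope.
Local Open Scope sesquilinear_scope.

(** Functions on [t0, +oo[ are represented by total functions on R; every
    notion below depends only on their values on [t0, +oo[. *)
Section Calculus.
Variables (R : realType) (t0 : R).

(* The limit is taken inside [t0, +oo[: it is the usual derivative at t > t0
   and the right derivative at t0. *)
Definition deriv_on (f f' : R -> R) : Prop :=
  forall t, t0 <= t ->
    (f s - f t) / (s - t) @[s --> within `[t0, +oo[ t^'] --> f' t.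

Definition mx_deriv_on n (M M' : R -> 'M[R[i]]_n) : Prop :=
  forall i j,
    deriv_on (fun t => complex.Re (M t i j)) (fun t => complex.Re (M' t i j)) /\
    deriv_on (fun t => complex.Im (M t i j)) (fun t => complex.Im (M' t i j)).

Definition mx_continuous_on n (M : R -> 'M[R[i]]_n) : Prop :=
  forall i j,
    {within `[t0, +oo[, continuous (fun t => complex.Re (M t i j))} /\
    {within `[t0, +oo[, continuous (fun t => complex.Im (M t i j))}.

(* M is continuously differentiable on [t0, +oo[, with derivative M'. *)
Definition mx_C1_on n (M M' : R -> 'M[R[i]]_n) : Prop :=
  mx_deriv_on M M' /\ mx_continuous_on M'.

Definition arbitrarily_large_zeroes (K : nmodType) (f : R -> K) : Prop :=
  forall T : R, exists t : R, [/\ t0 <= t, T <= t & f t = 0].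

End Calculus.

Section MatrixNotions.
Variables (R : realType) (n : nat).
Implicit Types M H : 'M[R[i]]_n.

(* The order of R[i] is used: 0 <= z means that z is real and nonnegative. *)
Definition nonneg_definite H : Prop :=
  forall v : 'cV[R[i]]_n, 0 <= (v^t* *m H *m v) 0 0.

(* For hermitian H and n > 0 all eigenvalues are real and the set below is
   finite and nonempty, so that the infimum is attained. *)
Definition least_eigenvalue H : R := inf [set x : R | eigenvalue H x%:C].

Definition Omega M : Prop :=
  M \is normalmx /\
  forall a b : R[i], eigenvalue M a -> eigenvalue M b ->
    complex.Re a = complex.Re b.

(* The real part of a chosen eigenvalue; for M in Omega and n > 0 it does not
   depend on the choice. *)
Definition W M : R :=
  xget 0 [set complex.Re a | a in [set a : R[i] | eigenvalue M a]].

End MatrixNotions.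

Section Systems.
Variables (R : realType) (t0 : R).

(** phi' = a phi + b psi,  psi' = c phi + d psi *)
Definition scalar_solution (a b c d phi psi : R -> R) : Prop :=
  deriv_on t0 phi (fun t => a t * phi t + b t * psi t) /\
  deriv_on t0 psi (fun t => c t * phi t + d t * psi t).

Definition scalar_oscillatory (a b c d : R -> R) : Prop :=
  forall phi psi, scalar_solution a b c d phi psi ->
    arbitrarily_large_zeroes t0 phi.

Variable n : nat.
Implicit Types A B C S dS Phi Psi : R -> 'M[R[i]]_n.

(** Phi' = A Phi + B Psi,  Psi' = C Phi - A^* Psi *)
Definition hamiltonian_solution A B C Phi Psi : Prop :=
  mx_C1_on t0 Phi (fun t => A t *m Phi t + B t *m Psi t) /\
  mx_C1_on t0 Psi (fun t => C t *m Phi t - (A t)^t* *m Psi t).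

Definition prepared Phi Psi : Prop :=
  forall t, t0 <= t -> (Phi t)^t* *m Psi t = (Psi t)^t* *m Phi t.

Definition hamiltonian_oscillatory A B C : Prop :=
  forall Phi Psi, hamiltonian_solution A B C Phi Psi -> prepared Phi Psi ->
    arbitrarily_large_zeroes t0 (fun t => \det (Phi t)).

Definition sigma A B S (t : R) : R := W ((A t)^t* + S t *m B t).

Definition DS A B C S dS (t : R) : 'M[R[i]]_n :=
  dS t + S t *m B t *m S t + (A t)^t* *m S t + S t *m A t - C t.

End Systems.

(* Main.v *)
Require Import Defs.
From HB Require Import structures.
From mathcomp Require Import all_boot all_order all_algebra.
From mathcomp Require Import complex.
From mathcomp Require Import all_classical all_reals all_analysis.
From mathcomp Require Import ring lra.

Set Implicit Arguments.
Unset Strict Implicit.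
Unset Printing Implicit Defensive.

Import Order.TTheory GRing.Theory Num.Theory.
Import numFieldNormedType.Exports.

Local Open Scope classical_set_scope.
Local Open Scope ring_scope.
Local Open Scope complex_scope.
Local Open Scope sesquilinear_scope.

(** Suppose [det Phi] has no zero on [T, +oo[. Then [Y = Psi Phi^-1] is hermitian
    and solves a matrix Riccati equation, and [Z = Y - S] satisfies
      [Z' + Z B Z + M Z + Z M^* + D_S = 0]  with  [M = A^* + S B].
    Membership of [M] in [Omega] means [M + M^* = 2 sigma 1], and
    [tr (Z B Z) >= lambda(B) tr (Z^2) >= lambda(B) (tr Z)^2 / n], so that
    [z = tr Z] satisfies the scalar Riccati inequality
      [z' + (lambda(B) / n) z^2 + 2 sigma z + tr D_S <= 0]  on [T, +oo[.
    The solution of the scalar system with [phi T = 1] and [psi T = z T] then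
    has [phi] nonvanishing on [T, +oo[, so the scalar system is not
    oscillatory. *)

(** By cyclicity the linear terms contribute tr ((M^* + M) Z) to the trace of the matrix equation;
    when M^* + M is scalar this is a multiple of tr Z, and so the trace closes up in z. Two
    obstacles shape the rest. The scalar hypothesis speaks of solutions on all of [t0, +oo[, whereas
    z exists only from T on: the contradicting solution carries its data at T and has to be
    continued back to t0. This calls for global existence for planar linear systems. That in turn
    needs continuous coefficients, although [W] is a choice and [least_eigenvalue] an infimum: the
    former is recovered as Re (tr M) / n, the latter is Lipschitz in the entries of the matrix by
    the Rayleigh principle. Comparing psi / phi with z would presuppose that phi does not vanish,
    which is the point to be proved; the comparison therefore goes through the sign of phi (psi - z
    phi), which makes sense at zeros of phi and allows lambda(B) to vanish. *)

(** * Limits, derivatives and primitives on a closed half-line *)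

Section OneSidedCalculus.
Variables (R : realType) (t0 : R).
Implicit Types (f g h df dg : R -> R) (s t : R).

Local Notation half := `[t0, +oo[%classic.

(** The points to the right of [t] stay in the half-line, even for t = t0. Uniqueness of one-sided
    derivatives rests on this. *)
Lemma within_dnbhs_proper t : t0 <= t -> ProperFilter (within half t^').
Proof.
move=> t0t; apply: Build_ProperFilter_ex => P; rewrite /within /= =>
  /nbhs_ballP[e /= e0 He].
exists (t + e / 2); apply: He; rewrite /= ?in_itv /= ?andbT.
- by rewrite /ball /= opprD addNKr normrN gtr0_norm; lra.
- by rewrite -subr_eq0 addrAC subrr add0r lt0r_neq0//; lra.
- by rewrite (le_trans t0t)//; lra.
Qed.

Lemma cont_onP f :
  {within half, continuous f} <->
  forall t, t0 <= t -> f s @[s --> within half (nbhs t)] --> f t.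
Proof.
rewrite subspace_continuousP; split=> H t; last by rewrite /= in_itv /= andbT;
  exact: H.
by move=> t0t; apply: H; rewrite /= in_itv /= andbT.
Qed.

Lemma cont_on_cst c : {within half, continuous (fun=> c : R)}.
Proof. by apply/cont_onP => t _; exact: cvg_cst. Qed.

Lemma cont_onD f g : {within half, continuous f} ->
  {within half, continuous g} -> {within half, continuous (fun t => f t + g t)}.
Proof.
move=> /cont_onP cf /cont_onP cg; apply/cont_onP => t t0t.
by apply: cvgD; [exact: cf|exact: cg].
Qed.

Lemma cont_onM f g : {within half, continuous f} ->
  {within half, continuous g} -> {within half, continuous (fun t => f t * g t)}.
Proof.
move=> /cont_onP cf /cont_onP cg; apply/cont_onP => t t0t.
by apply: cvgM; [exact: cf|exact: cg].
Qed.

Lemma cont_onN f : {within half, continuous f} ->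
  {within half, continuous (fun t => - f t)}.
Proof.
by move=> /cont_onP cf; apply/cont_onP => t t0t; apply: cvgN; exact: cf.
Qed.

Lemma cont_onB f g : {within half, continuous f} ->
  {within half, continuous g} -> {within half, continuous (fun t => f t - g t)}.
Proof. by move=> cf cg; apply: cont_onD => //; exact: cont_onN. Qed.

Lemma cont_on_sum (I : Type) (r : seq I) (P : pred I) (F : I -> R -> R) :
  (forall i, {within half, continuous (F i)}) ->
  {within half, continuous (fun t => \sum_(i <- r | P i) F i t)}.
Proof.
move=> cF; elim: r => [|i r IHr].
  rewrite (_ : (fun t => _) = fun=> 0); first exact: cont_on_cst.
  by apply/funext => t; rewrite big_nil.
rewrite (_ : (fun t => _) =
  fun t => (if P i then F i t else 0) + \sum_(j <- r | P j) F j t).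
  by apply: cont_onD => //; case: (P i) => //; exact: cont_on_cst.
by apply/funext => t; rewrite big_cons; case: (P i); rewrite ?add0r.
Qed.

Lemma cont_on_eq f g : (forall t, t0 <= t -> f t = g t) ->
  {within half, continuous f} -> {within half, continuous g}.
Proof.
move=> fg /cont_onP cf; apply/cont_onP => t t0t; rewrite -fg//.
apply: cvg_trans (cf t t0t); apply: near_eq_cvg.
by rewrite near_withinE; near=> s => /=; rewrite in_itv /= andbT => /fg.
Unshelve. all: by end_near. Qed.

(** First-order expansion in place of the quotient: at s = t both sides vanish, so the punctured
    neighbourhood disappears and restriction to a smaller half-line becomes immediate. *)
Lemma deriv_onP f df : deriv_on t0 f df <->
  forall t, t0 <= t -> forall e, 0 < e -> exists2 d, 0 < d &
    forall s, t0 <= s -> `|s - t| < d ->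
      `|f s - f t - df t * (s - t)| <= e * `|s - t|.
Proof.
split=> [H t t0t e e0|H t t0t].
  have := H t t0t => /cvgrPdist_le/(_ _ e0).
  rewrite near_withinE => /nbhs_ballP[d /= d0 Hd].
  exists d => // s t0s std; have [->|nst] := eqVneq s t.
    by rewrite !subrr mulr0 subrr normr0 mulr0.
  have nst0 : s - t != 0 by rewrite subr_eq0.
  have /= := Hd s; rewrite /ball /= distrC => /(_ std nst).
  rewrite in_itv /= andbT => /(_ t0s).
  have -> : f s - f t - df t * (s - t) =
    - ((df t - (f s - f t) / (s - t)) * (s - t)).
    by rewrite mulrBl divfK// opprB.
  by rewrite normrN normrM ler_pM2r// normr_gt0.
apply/cvgrPdist_le => e e0; have [d d0 Hd] := H t t0t e e0.
rewrite near_withinE; apply/nbhs_ballP; exists d => //= s.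
rewrite /ball /= distrC => std nst; rewrite in_itv /= andbT => t0s.
have nst0 : s - t != 0 by rewrite subr_eq0.
have := Hd s t0s std.
have -> : f s - f t - df t * (s - t) =
    - ((df t - (f s - f t) / (s - t)) * (s - t)).
  by rewrite mulrBl divfK// opprB.
by rewrite normrN normrM ler_pM2r// normr_gt0.
Qed.

Lemma deriv_on_cont f df : deriv_on t0 f df -> {within half, continuous f}.
Proof.
move=> H; apply/cont_onP => t t0t; apply/cvgrPdist_le => e e0.
have [d d0 Hd] := (deriv_onP f df).1 H t t0t 1 ltr01.
rewrite near_withinE; near=> s => /=; rewrite in_itv /= andbT => t0s.
have std : `|s - t| < d by rewrite distrC; near: s; exact: nbhsx_ballx.
have := Hd s t0s std; rewrite mul1r => Hs.
rewrite distrC.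
have -> : f s - f t = (f s - f t - df t * (s - t)) + df t * (s - t) by ring.
rewrite (le_trans (ler_normD _ _))// (le_trans (lerD Hs (lexx _)))//.
rewrite normrM -{1}(mul1r `|s - t|) -mulrDl mulrC -ler_pdivlMr;
  last by rewrite ltr_pwDl.
apply: ltW; rewrite distrC; near: s; apply: nbhsx_ballx.
by rewrite divr_gt0// ltr_pwDl.
Unshelve. all: by end_near. Qed.

Lemma deriv_on_eq f g df dg : (forall t, t0 <= t -> f t = g t) ->
  (forall t, t0 <= t -> df t = dg t) -> deriv_on t0 f df -> deriv_on t0 g dg.
Proof.
move=> fg dfg /deriv_onP H; apply/deriv_onP => t t0t e e0.
have [d d0 Hd] := H t t0t e e0; exists d => // s t0s std.
by rewrite -!fg// -dfg//; exact: Hd.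
Qed.

Lemma deriv_on_cst c : deriv_on t0 (fun=> c) (fun=> 0).
Proof. by apply/deriv_onP => t t0t e e0; exists 1 => // s _ _;
  rewrite mul0r !subrr normr0 mulr_ge0// ltW. Qed.

Lemma deriv_onD f g df dg : deriv_on t0 f df -> deriv_on t0 g dg ->
  deriv_on t0 (fun t => f t + g t) (fun t => df t + dg t).
Proof.
move=> Hf Hg t t0t.
under eq_fun do rewrite opprD addrACA mulrDl.
by apply: cvgD; [exact: Hf|exact: Hg].
Qed.

Lemma deriv_onN f df : deriv_on t0 f df ->
  deriv_on t0 (fun t => - f t) (fun t => - df t).
Proof.
move=> Hf t t0t.
under eq_fun do rewrite -opprD mulNr.
by apply: cvgN; exact: Hf.
Qed.

Lemma deriv_onB f g df dg : deriv_on t0 f df -> deriv_on t0 g dg ->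
  deriv_on t0 (fun t => f t - g t) (fun t => df t - dg t).
Proof. by move=> Hf Hg; apply: deriv_onD => //; exact: deriv_onN. Qed.

Lemma cvg_within_dnbhs f t (l : R) :
  f s @[s --> within half (nbhs t)] --> l -> f s @[s --> within half t^'] --> l.
Proof.
apply: cvg_trans; apply: cvg_app => P; rewrite /within /= =>
  /nbhs_ballP[e e0 He].
by apply/nbhs_ballP; exists e => // s /He.
Qed.

Lemma deriv_onM f g df dg : deriv_on t0 f df -> deriv_on t0 g dg ->
  deriv_on t0 (fun t => f t * g t) (fun t => df t * g t + f t * dg t).
Proof.
move=> Hf Hg t t0t.
(* The inverse of s - t is a mere atom here, so the identity holds at s = t too. *)
have E s : (f s * g s - f t * g t) / (s - t) =
  (f s - f t) / (s - t) * g t + f s * ((g s - g t) / (s - t)).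
  by ring.
under eq_fun do rewrite E.
apply: cvgD; apply: cvgM; [exact: Hf|exact: cvg_cst| |exact: Hg].
by apply: cvg_within_dnbhs; have /deriv_on_cont/cont_onP := Hf; apply.
Qed.

Lemma deriv_onV f df : (forall t, t0 <= t -> f t != 0) -> deriv_on t0 f df ->
  deriv_on t0 (fun t => (f t)^-1) (fun t => - df t / f t ^+ 2).
Proof.
move=> f0 Hf t t0t.
have ft0 := f0 t t0t.
have -> : - df t / f t ^+ 2 = (- df t) * ((f t)^-1 / f t)
  by rewrite -invrM ?unitfE.
suff : - ((f s - f t) / (s - t)) * ((f s)^-1 / f t) @[s --> within half t^'] -->
  - df t * ((f t)^-1 / f t).
  apply: cvg_trans; apply: near_eq_cvg; rewrite near_withinE.
  apply: filterE => s; rewrite /= in_itv /= andbT => t0s.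
  have fs0 := f0 s t0s.
  (* At s = t both sides are 0, since the inverse of 0 is 0. *)
  have [->|st] := eqVneq s t; first by rewrite !subrr invr0 !mulr0 oppr0 mul0r.
  by field; rewrite ?fs0 ?ft0 ?subr_eq0 ?st.
apply: cvgM; first by apply: cvgN; exact: Hf.
apply: cvgMr_tmp; apply: cvgV => //.
by apply: cvg_within_dnbhs; have /deriv_on_cont/cont_onP := Hf; apply.
Qed.

Lemma deriv_on_sum (I : Type) (r : seq I) (P : pred I) (F dF : I -> R -> R) :
  (forall i, deriv_on t0 (F i) (dF i)) ->
  deriv_on t0 (fun t => \sum_(i <- r | P i) F i t)
    (fun t => \sum_(i <- r | P i) dF i t).
Proof.
move=> HF; elim: r => [|i r IHr].
  apply: (deriv_on_eq _ _ (deriv_on_cst 0)) => t _; by rewrite big_nil.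
case Pi : (P i); last first.
  by apply: (deriv_on_eq _ _ IHr) => t _; rewrite big_cons Pi.
by apply: (deriv_on_eq _ _ (deriv_onD (HF i) IHr)) => t _; rewrite big_cons Pi.
Qed.

Lemma deriv_on_uniq f df dg : deriv_on t0 f df -> deriv_on t0 f dg ->
  forall t, t0 <= t -> df t = dg t.
Proof.
move=> Hf Hg t t0t; have := within_dnbhs_proper t0t => PF.
exact: (cvg_unique (@Rhausdorff R) (Hf t t0t) (Hg t t0t)).
Qed.

Lemma is_derive_deriv_on f df : (forall t, t0 <= t -> is_derive t 1 f (df t)) ->
  deriv_on t0 f df.
Proof.
move=> H; apply/deriv_onP => t t0t e e0.
have [Hd /= Hv] := H t t0t.
have /cvgrPdist_le/(_ _ e0) : h^-1 *: ((f \o shift t) (h *: 1) - f t)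
  @[h --> 0^'] --> df t.
  by rewrite -Hv; exact: Hd.
move=> /nbhs_ballP[d /= d0 {}Hd].
exists d => // s t0s std; have [->|nst] := eqVneq s t.
  by rewrite !subrr mulr0 subrr normr0 mulr0.
have nst0 : s - t != 0 by rewrite subr_eq0.
have /= := Hd (s - t); rewrite /ball /= sub0r normrN => /(_ std nst0).
rewrite /GRing.scale /= mulr1 subrK => Hs.
have -> : f s - f t - df t * (s - t) =
  - ((df t - (s - t)^-1 * (f s - f t)) * (s - t)).
  by rewrite mulrBl mulrAC mulVf// mul1r opprB.
by rewrite normrN normrM ler_pM2r// normr_gt0.
Qed.

Lemma deriv_on_is_derive f df : deriv_on t0 f df ->
  forall t, t0 < t -> is_derive t 1 f (df t).
Proof.
move=> /deriv_onP H t t0t.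
suff Hc : h^-1 *: ((f \o shift t) (h *: 1) - f t) @[h --> 0^'] --> df t.
  have Hd : derivable f t 1 by apply/cvg_ex; exists (df t).
  by apply: DeriveDef => //; apply/cvg_lim.
apply/cvgrPdist_le => e e0; have [d d0 Hd] := H t (ltW t0t) e e0.
have td : 0 < t - t0 by rewrite subr_gt0.
near=> h.
have h0 : h != 0 by near: h; exact: nbhs_dnbhs_neq.
have hd : `|h| < d.
  by near: h; apply: dnbhs0_lt.
have ht : `|h| < t - t0.
  by near: h; apply: dnbhs0_lt.
have t0h : t0 <= h + t.
  by move: ht; rewrite ltr_norml => /andP[+ _]; rewrite opprB ltrBlDr => /ltW.
have := Hd (h + t) t0h; rewrite addrK => /(_ hd).
rewrite /GRing.scale /= mulr1.
have -> : f (h + t) - f t - df t * h =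
  - ((df t - h^-1 * (f (h + t) - f t)) * h).
  by rewrite mulrBl mulrAC mulVf// mul1r opprB.
by rewrite normrN normrM ler_pM2r// normr_gt0.
Unshelve. all: by end_near. Qed.

Lemma deriv_on_ge0_nd f df : deriv_on t0 f df ->
  (forall t, t0 <= t -> 0 <= df t) ->
  forall s t, t0 <= s -> s <= t -> f s <= f t.
Proof.
move=> Hf df0 s t t0s; rewrite le_eqVlt => /predU1P[->//|st].
have [||c] := MVT (f := f) (df := df) st.
- move=> x; rewrite in_itv /= => /andP[sx _].
  by apply: deriv_on_is_derive => //; exact: le_lt_trans sx.
- apply: continuous_subspaceW (deriv_on_cont Hf) => x /=.
  by rewrite !in_itv /= andbT => /andP[sx _]; exact: le_trans sx.
rewrite in_itv /= => /andP[sc _] E.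
by rewrite -subr_ge0 E mulr_ge0 ?subr_ge0 ?(ltW st)// df0// (le_trans t0s)//
  ltW.
Qed.

(** Mean value theorem for g - f. The horizon [T] is there because the bounds on coefficients are
    available on compact intervals only. *)
Lemma deriv_on_le f g df dg : deriv_on t0 f df -> deriv_on t0 g dg ->
  forall T, f t0 <= g t0 ->
  (forall t, t0 <= t <= T -> df t <= dg t) ->
  forall t, t0 <= t <= T -> f t <= g t.
Proof.
move=> Hf Hg T fg0 dfg t /andP[t0t tT].
have Hh := deriv_onB Hg Hf.
move: t0t; rewrite le_eqVlt => /predU1P[<-//|t0t].
have [||c] := MVT (f := fun t => g t - f t) (df := fun t => dg t - df t) t0t.
- move=> x; rewrite in_itv /= => /andP[sx _].
  exact: (deriv_on_is_derive Hh).
- apply: continuous_subspaceW (deriv_on_cont Hh) => x /=.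
  by rewrite !in_itv /= andbT => /andP[sx _].
rewrite in_itv /= => /andP[t0c ct] E.
have : 0 <= g t - f t - (g t0 - f t0).
  by rewrite E mulr_ge0 ?subr_ge0 ?(ltW t0t)// dfg// (ltW t0c)
    (le_trans (ltW ct)).
by rewrite subr_ge0 => H; rewrite -subr_ge0 (le_trans _ H)// subr_ge0.
Qed.

Lemma deriv_on_eq0_cst f : deriv_on t0 f (fun=> 0) ->
  forall t, t0 <= t -> f t = f t0.
Proof.
move=> Hf t t0t; apply/eqP; rewrite eq_le; apply/andP; split; last first.
  by apply: (deriv_on_ge0_nd Hf).
rewrite -lerN2; apply: (deriv_on_ge0_nd (deriv_onN Hf)) => // s _ /=;
  rewrite oppr0.
Qed.

Lemma primitive_on f : {within half, continuous f} ->
  exists2 F, F t0 = 0 & deriv_on t0 F f.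
Proof.
(* Constant extension to the left of t0 and integration from t0 - 1 give a
   two-sided derivative at t0. *)
move=> /cont_onP cf; pose g t := f (Num.max t t0).
have cg : continuous g.
  move=> t; apply/cvgrPdist_le => e e0.
  have m0 : t0 <= Num.max t t0 by rewrite le_max lexx orbT.
  have /cvgrPdist_le/(_ _ e0) := cf _ m0.
  rewrite near_withinE => /nbhs_ballP[d /= d0 Hd].
  near=> s; apply: Hd; last by rewrite /= in_itv /= andbT le_max lexx orbT.
  rewrite /ball /=.
  have st : `|t - s| < d by near: s; exact: (nbhsx_ballx t d d0).
  apply: le_lt_trans st.
  by rewrite /Num.max; case: ltP => ?; case: ltP => ?; rewrite ler_norml;
    apply/andP; split;
     have := ler_norm (t - s); have := ler_norm (- (t - s)); rewrite ?normrN;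
       lra.
pose G t := (\int[lebesgue_measure]_(x in `[t0 - 1, t]) g x)%R.
exists (fun t => G t - G t0); first by rewrite subrr.
have -> : f = (fun t => f t - 0) by apply/funext => t; rewrite subr0.
apply: deriv_onB; last exact: deriv_on_cst.
apply: (@deriv_on_eq G G g f) => //; first by move=> t t0t; rewrite /g max_l.
apply: is_derive_deriv_on => t t0t.
have [||||dG vG] := @continuous_FTC1_closed R g (t0 - 1) t (t + 1).
- by rewrite ltrDl.
- apply: continuous_compact_integrable; first exact: segment_compact.
  exact: continuous_subspaceT.
- by rewrite ltrBlDr (le_lt_trans t0t)// ltrDl.
- exact: cg.
apply: DeriveDef; first exact: dG.
by rewrite -derive1E; exact: vG.
Unshelve. all: by end_near. Qed.

End OneSidedCalculus.

Lemma deriv_onW (R : realType) (t0 T : R) f df : t0 <= T ->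
  deriv_on t0 f df -> deriv_on T f df.
Proof.
move=> t0T /deriv_onP H; apply/deriv_onP => t Tt e e0.
have [d d0 Hd] := H t (le_trans t0T Tt) e e0.
by exists d => // s Ts; apply: Hd; exact: le_trans Ts.
Qed.

Lemma cont_onW (R : realType) (t0 T : R) (f : R -> R) : t0 <= T ->
  {within `[t0, +oo[, continuous f} -> {within `[T, +oo[, continuous f}.
Proof.
move=> t0T; apply: continuous_subspaceW => x /=.
by rewrite !in_itv /= !andbT; exact: le_trans.
Qed.

Lemma expR_deriv_on (R : realType) (t0 L : R) :
  deriv_on t0 (fun t => expR (L * (t - t0))) (fun t => L * expR (L * (t - t0))).
Proof.
apply: is_derive_deriv_on => t _.
have H : is_derive t 1 (fun t => L * (t - t0)) L.
  by apply: is_derive_eq; rewrite subr0 /GRing.scale /= mulr1.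
have := @is_derive1_comp _ expR (fun t => L * (t - t0)) t _ _ _ H.
by move=> /(_ _ (is_derive_expR _)); rewrite mulrC.
Qed.

(** * Global existence for planar linear systems by Picard iteration *)

Section LinearSystem.
Variables (R : realType) (t0 : R).
Implicit Types (f g h df dg dh : R -> R) (s t X : R).

Local Notation half := `[t0, +oo[%classic.

Lemma cont_on_bounded f X : {within half, continuous f} ->
  exists2 K : R, 0 < K & forall t, t0 <= t <= X -> `|f t| <= K.
Proof.
move=> cf; have [t0X|Xt0] := leP t0 X; last first.
  by exists 1 => // t /andP[t0t tX]; have := lt_le_trans Xt0 (le_trans t0t tX);
    rewrite ltxx.
(* The maximum of f^2 controls both signs of f at once, and |u| <= u^2 + 1 avoids a square root. *)
have [|c _ Hc] := @EVT_max R (fun t => f t * f t) t0 X t0X.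
  apply: continuous_subspaceW (cont_onM cf cf) => x /=.
  by rewrite !in_itv /= andbT => /andP[].
exists (f c * f c + 1) => [|t tX]; first by have := sqr_ge0 (f c);
  rewrite expr2; lra.
have := Hc t tX; have : f t * f t = `|f t| * `|f t|.
  by rewrite -normrM ger0_norm// -expr2 sqr_ge0.
move=> ->; have := sqr_ge0 (`|f t| - 1); nra.
Qed.

(** Plays the role of bounding an integral by the integral of a majorant: all Picard estimates are
    made on derivatives. *)
Lemma deriv_on_abs_le f h df dh X : deriv_on t0 f df -> deriv_on t0 h dh ->
  f t0 = 0 -> 0 <= h t0 ->
  (forall t, t0 <= t <= X -> `|df t| <= dh t) ->
  forall t, t0 <= t <= X -> `|f t| <= h t.
Proof.
move=> Hf Hh f0 h0 H t tX; rewrite ler_norml; apply/andP; split.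
  rewrite lerNl; apply: (deriv_on_le (deriv_onN Hf) Hh _ _ tX);
    first by rewrite f0 oppr0.
  by move=> s /H; apply: le_trans; rewrite -normrN ler_norm.
apply: (deriv_on_le Hf Hh _ _ tX); first by rewrite f0.
by move=> s /H; apply: le_trans; rewrite ler_norm.
Qed.

Lemma geometric_small (C e : R) : 0 < e -> exists k, C / 2 ^+ k <= e.
Proof.
move=> e0; have := @cvg_geometric R C 2^-1.
rewrite ger0_norm ?invr_ge0// invf_lt1// ltr1n =>
  /(_ isT) /cvgrPdist_le/(_ _ e0)[k _ Hk].
exists k; have := Hk k (leqnn k); rewrite sub0r normrN /geometric /= -exprVn.
exact/le_trans/ler_norm.
Qed.

(** The remaining increments after index k sum to at most 2 C / 2^k. Hence u_k - 2 C / 2^k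
    increases, u_k + 2 C / 2^k decreases, and the supremum of the former lies between the two and is
    the limit. *)
Lemma geometric_lim (u : nat -> R) (C : R) :
  (forall k, `|u k.+1 - u k| <= C / 2 ^+ k) ->
  forall k, `|limn u - u k| <= 2 * C / 2 ^+ k.
Proof.
move=> Hu; have C0 : 0 <= C by have := Hu 0; rewrite expr0 divr1;
  apply: le_trans.
have p2 k : 2 * C / 2 ^+ k = C / 2 ^+ k + 2 * C / 2 ^+ k.+1 :> R.
  by rewrite exprS; field; rewrite expf_neq0.
have v_nd : nondecreasing_seq (fun k => u k - 2 * C / 2 ^+ k).
  apply/nondecreasing_seqP => k; have := Hu k; rewrite ler_norml => /andP[H _].
  by rewrite (p2 k); lra.
have w_ni : nonincreasing_seq (fun k => u k + 2 * C / 2 ^+ k).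
  apply/nonincreasing_seqP => k; have := Hu k; rewrite ler_norml => /andP[_ H].
  by rewrite (p2 k); lra.
have q0 k : 0 <= 2 * C / 2 ^+ k by rewrite divr_ge0 ?mulr_ge0 ?exprn_ge0.
have vw k m : u k - 2 * C / 2 ^+ k <= u m + 2 * C / 2 ^+ m.
  have := v_nd k (maxn k m) (leq_maxl _ _).
  have := w_ni m (maxn k m) (leq_maxr _ _).
  by have := q0 (maxn k m); lra.
pose l := sup (range (fun k => u k - 2 * C / 2 ^+ k)).
have Hl k : `|l - u k| <= 2 * C / 2 ^+ k.
  have H1 : u k - 2 * C / 2 ^+ k <= l.
    apply: ub_le_sup; last by exists k.
    by exists (u 0 + 2 * C / 2 ^+ 0) => _ [m _ <-]; exact: vw.
  have H2 : l <= u k + 2 * C / 2 ^+ k.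
    apply: ge_sup; first by exists (u 0 - 2 * C / 2 ^+ 0); exists 0%N.
    by move=> _ [m _ <-]; exact: vw.
  by rewrite ler_norml; apply/andP; split; lra.
suff -> : limn u = l by [].
apply/cvg_lim; first exact: Rhausdorff.
apply/cvgrPdist_le => e e0; have [k Hk] := geometric_small (2 * C) e0.
exists k => // m /= km; apply: le_trans (Hl m) _; apply: le_trans _ Hk.
apply: ler_wpM2l; first by rewrite mulr_ge0.
by rewrite lef_pV2 ?posrE ?exprn_gt0// ler_weXn2l ?ler1n.
Qed.

(** A choice with a default value, so that [picard] can be defined before its iterates are known to
    be continuous. *)
Definition primitive f : R -> R :=
  xget (fun=> 0) [set F | F t0 = 0 /\ deriv_on t0 F f].

Lemma primitiveP f : {within half, continuous f} ->
  primitive f t0 = 0 /\ deriv_on t0 (primitive f) f.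
Proof.
move=> /primitive_on[F F0 HF]; rewrite /primitive.
by case: xgetP => [G _ [] //|/(_ F)[]].
Qed.

Variables (a b c d : R -> R) (x0 y0 : R).
Hypotheses (ca : {within half, continuous a}) (cb : {within half, continuous b})
  (cc : {within half, continuous c}) (cd : {within half, continuous d}).

Fixpoint picard (k : nat) : (R -> R) * (R -> R) :=
  if k is k'.+1 then
    let: (x, y) := picard k' in
    (fun t => x0 + primitive (fun s => a s * x s + b s * y s) t,
     fun t => y0 + primitive (fun s => c s * x s + d s * y s) t)
  else (fun=> x0, fun=> y0).

Let x k := (picard k).1.
Let y k := (picard k).2.

Lemma picard_step (p q : R -> R) : {within half, continuous p} ->
  {within half, continuous q} ->
  forall (z0 : R) f g, {within half, continuous f} ->
    {within half, continuous g} ->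
  let F := fun t => z0 + primitive (fun s => p s * f s + q s * g s) t in
  F t0 = z0 /\ deriv_on t0 F (fun s => p s * f s + q s * g s).
Proof.
move=> cp cq z0 f g cf cg F.
have [|F0 HF] := @primitiveP (fun s => p s * f s + q s * g s).
  by apply: cont_onD; exact: cont_onM.
split; first by rewrite /F F0 addr0.
by apply: (deriv_on_eq _ _ (deriv_onD (deriv_on_cst z0) HF)) => // t _;
  rewrite add0r.
Qed.

Lemma picard_cont k : {within half, continuous (x k)} /\
  {within half, continuous (y k)}.
Proof.
elim: k => [|k]; first by split; exact: cont_on_cst.
rewrite /x /y /=; case: (picard k) => f g /= [cf cg]; split.
  exact: deriv_on_cont (picard_step ca cb x0 cf cg).2.
exact: deriv_on_cont (picard_step cc cd y0 cf cg).2.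
Qed.

(** The equations start at index [k.+1] because the iterate of index 0 is a constant, not the result
    of an integration. *)
Lemma picardS k :
  [/\ x k t0 = x0, y k t0 = y0,
      deriv_on t0 (x k.+1) (fun s => a s * x k s + b s * y k s) &
      deriv_on t0 (y k.+1) (fun s => c s * x k s + d s * y k s)].
Proof.
have D j :
  (x j.+1 t0 = x0 /\
   deriv_on t0 (x j.+1) (fun s => a s * x j s + b s * y j s)) /\
  (y j.+1 t0 = y0 /\
   deriv_on t0 (y j.+1) (fun s => c s * x j s + d s * y j s)).
  have := picard_cont j; rewrite /x /y /=; case: (picard j) => f g /= [cf cg].
  by split; exact: picard_step.
have [[_ Dx] [_ Dy]] := D k.
by split => //; case: k {Dx Dy} => // k; have [[] ? _ []] := D k.
Qed.

Lemma picard_coef_bound X : exists2 K : R, 0 < K & forall t, t0 <= t <= X ->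
  [/\ `|a t| <= K, `|b t| <= K, `|c t| <= K & `|d t| <= K].
Proof.
have [Ka a0 Ha] := cont_on_bounded X ca.
have [Kb b0 Hb] := cont_on_bounded X cb.
have [Kc c0 Hc] := cont_on_bounded X cc.
have [Kd d0 Hd] := cont_on_bounded X cd.
exists (Ka + Kb + Kc + Kd) => [|t tX]; first lra.
have := Ha t tX; have := Hb t tX; have := Hc t tX; have := Hd t tX.
by move=> ? ? ? ?; split; lra.
Qed.

Lemma combination_bound (K M p q u v : R) :
  `|p| <= K -> `|q| <= K -> `|u| <= M -> `|v| <= M ->
    `|p * u + q * v| <= 2 * K * M.
Proof.
move=> pK qK uM vM; apply: le_trans (ler_normD _ _) _; rewrite !normrM.
have -> : 2 * K * M = K * M + K * M by ring.
by apply: lerD; apply: ler_pM.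
Qed.

(* The weight exp (4 K (t - t0)) makes each Picard step contract by 1/2. *)
Lemma picard_diff X : exists C : R, forall k t, t0 <= t <= X ->
  `|x k.+1 t - x k t| <= C / 2 ^+ k /\ `|y k.+1 t - y k t| <= C / 2 ^+ k.
Proof.
have [K K0 HK] := picard_coef_bound X.
have [M1 M10 HM1] :=
  cont_on_bounded X (cont_onB (picard_cont 1).1 (picard_cont 0).1).
have [M2 M20 HM2] :=
  cont_on_bounded X (cont_onB (picard_cont 1).2 (picard_cont 0).2).
pose E t := expR (4 * K * (t - t0)).
pose M : R := M1 + M2.
have M0 : 0 < M by rewrite /M addr_gt0.
have E1 t : t0 <= t -> 1 <= E t.
  by move=> t0t; rewrite /E -expR0 ler_expR !mulr_ge0 ?subr_ge0// ltW.
exists (M * E X).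
have H k t : t0 <= t <= X -> `|x k.+1 t - x k t| <= M / 2 ^+ k * E t /\
                             `|y k.+1 t - y k t| <= M / 2 ^+ k * E t.
  elim: k t => [t tX|k IHk t tX].
    have /andP[t0t _] := tX; have {}E1 := E1 t t0t.
    have := HM1 t tX; have := HM2 t tX; rewrite expr0 divr1 => H2 H1.
    have ME : M <= M * E t by rewrite ler_peMr// ltW.
    by split; apply: le_trans ME; rewrite /M; lra.
  (* Since 4 K / 2^(k+1) = 2 K / 2^k, the next majorant has as derivative exactly the bound given by
     [combination_bound]. *)
  have Dh : deriv_on t0 (fun t => M / 2 ^+ k.+1 * E t)
                        (fun t => 2 * K * (M / 2 ^+ k * E t)).
    have DE := deriv_onM (deriv_on_cst (M / 2 ^+ k.+1))
      (@expR_deriv_on R t0 (4 * K)).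
    apply: (deriv_on_eq _ _ DE) => // s _; rewrite mul0r add0r -/(E s) exprS.
    by field; rewrite expf_neq0.
  have h0 : 0 <= M / 2 ^+ k.+1 * E t0.
    by rewrite mulr_ge0 ?expR_ge0// divr_ge0 ?exprn_ge0// ltW.
  have [x1 y1 Dx1 Dy1] := picardS k.
  have [x2 y2 Dx2 Dy2] := picardS k.+1.
  split.
  - apply: (deriv_on_abs_le (deriv_onB Dx2 Dx1) Dh _ h0 _ tX).
      by have [-> _ _ _] := picardS k.+2; rewrite x2 subrr.
    move=> s sX; have [Ka Kb Kc Kd] := HK s sX; have [Hx Hy] := IHk s sX.
    rewrite (_ : _ - _ = a s * (x k.+1 s - x k s) + b s * (y k.+1 s - y k s));
      last by ring.
    exact: combination_bound.
  - apply: (deriv_on_abs_le (deriv_onB Dy2 Dy1) Dh _ h0 _ tX).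
      by have [_ -> _ _] := picardS k.+2; rewrite y2 subrr.
    move=> s sX; have [Ka Kb Kc Kd] := HK s sX; have [Hx Hy] := IHk s sX.
    rewrite (_ : _ - _ = c s * (x k.+1 s - x k s) + d s * (y k.+1 s - y k s));
      last by ring.
    exact: combination_bound.
move=> k t tX; have /andP[t0t tX'] := tX.
have EX : M / 2 ^+ k * E t <= M * E X / 2 ^+ k.
  rewrite [leRHS]mulrAC ler_wpM2l ?divr_ge0 ?exprn_ge0// ?(ltW M0)//.
  by rewrite ler_expR ler_wpM2l ?mulr_ge0// ?(ltW K0)// lerB.
by have [H1 H2] := H k t tX; split; apply: le_trans EX.
Qed.

Let xl t : R := limn (fun k => x k t).
Let yl t : R := limn (fun k => y k t).

Lemma picard_lim X : exists2 C : R, 0 <= C & forall k t, t0 <= t <= X ->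
  `|xl t - x k t| <= C / 2 ^+ k /\ `|yl t - y k t| <= C / 2 ^+ k.
Proof.
have [C HC] := picard_diff X.
(* When [t0, X] is empty the sign of [C] is unknown, hence the absolute value. *)
exists `|2 * C| => // k t tX.
have le_abs : 2 * C / 2 ^+ k <= `|2 * C| / 2 ^+ k.
  by rewrite ler_wpM2r ?invr_ge0 ?exprn_ge0// ler_norm.
have Hx j : `|x j.+1 t - x j t| <= C / 2 ^+ j by have [] := HC j t tX.
have Hy j : `|y j.+1 t - y j t| <= C / 2 ^+ j by have [] := HC j t tX.
by split; apply: le_trans le_abs; apply: (@geometric_lim (fun k => _ k t)).
Qed.

Lemma uniform_lim_cont (u : nat -> R -> R) (l : R -> R) :
  (forall k, {within half, continuous (u k)}) ->
  (forall X, exists C : R, forall k t, t0 <= t <= X ->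
    `|l t - u k t| <= C / 2 ^+ k) ->
  {within half, continuous l}.
Proof.
move=> cu Hu; apply/cont_onP => t t0t; apply/cvgrPdist_le => e e0.
(* The horizon t + 1 leaves room for a neighbourhood of [t] on which the convergence is uniform. *)
have [C HC] := Hu (t + 1).
have e3 : 0 < e / 3 by lra.
have [k Hk] := geometric_small C e3.
have /cont_onP/(_ t t0t)/cvgrPdist_le/(_ _ e3) := cu k.
rewrite !near_withinE => Hn; near=> s => /= sh; have t0s : t0 <= s.
  by move: sh; rewrite in_itv /= andbT.
have std : `|t - s| < 1 by near: s; exact: (nbhsx_ballx t 1 ltr01).
have tX : t0 <= t <= t + 1 by rewrite t0t lerDl ler01.
have sX : t0 <= s <= t + 1.
  by rewrite t0s; move: std; rewrite ltr_norml => /andP[? ?]; lra.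
have Ht := le_trans (HC k t tX) Hk; have Hls := le_trans (HC k s sX) Hk.
rewrite (_ : l t - l s = (l t - u k t) + (u k t - u k s) - (l s - u k s));
  last by ring.
apply: le_trans (ler_normB _ _) _.
have := ler_normD (l t - u k t) (u k t - u k s).
have Hs : `|u k t - u k s| <= e / 3 by move: sh; near: s; exact: Hn.
lra.
Unshelve. all: by end_near. Qed.

(** Serves both components, with (p, q) equal to (a, b) or (c, d). The integral [F] of the limiting
    right-hand side and the limit [wl] are both approached by w_(k+1) at geometric rate, so they
    coincide. *)
Lemma picard_fixpoint (p q : R -> R) (z0 : R) (w : nat -> R -> R) (wl : R -> R)
  :
  {within half, continuous p} -> {within half, continuous q} ->
  (forall k, w k t0 = z0) ->
  (forall k, deriv_on t0 (w k.+1) (fun s => p s * x k s + q s * y k s)) ->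
  (forall X, exists2 C : R, 0 <= C & forall k t, t0 <= t <= X ->
    `|wl t - w k t| <= C / 2 ^+ k) ->
  {within half, continuous xl} -> {within half, continuous yl} ->
  wl t0 = z0 /\ deriv_on t0 wl (fun s => p s * xl s + q s * yl s).
Proof.
move=> cp cq w0 Dw Hw cx cy.
pose F t := z0 + primitive (fun s => p s * xl s + q s * yl s) t.
have [F0 DF] : F t0 = z0 /\ deriv_on t0 F (fun s => p s * xl s + q s * yl s).
  exact: picard_step.
suff FE t : t0 <= t -> F t = wl t by split;
  [rewrite -FE|apply: (deriv_on_eq _ _ DF)].
move=> t0t; apply/eqP; rewrite -subr_eq0 -normr_le0; apply/ler_addgt0Pl => e e0.
have [C C0 HC] := picard_lim t; have [C' C'0 HC'] := Hw t.
have [K1 K10 HK1] := cont_on_bounded t cp.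
have [K2 K20 HK2] := cont_on_bounded t cq.
pose K := K1 + K2.
(* The constant adds up the two errors estimated in [H1] and [H2]. *)
have [k Hk] := geometric_small (2 * K * C * (t - t0) + C') e0.
have tX : t0 <= t <= t by rewrite t0t lexx.
have H1 : `|F t - w k.+1 t| <= 2 * K * (C / 2 ^+ k) * (t - t0).
  pose m := 2 * K * (C / 2 ^+ k).
  have Dh : deriv_on t0 (fun t => m * (t - t0)) (fun=> m).
    apply: is_derive_deriv_on => s _; apply: is_derive_eq.
    by rewrite subr0 /GRing.scale /= mulr1.
  apply: (deriv_on_abs_le (deriv_onB DF (Dw k)) Dh _ _ _ tX).
  - by rewrite F0 w0 subrr.
  - by rewrite subrr mulr0.
  move=> s sX; have [Hx Hy] := HC k s sX.
  rewrite (_ : _ - _ = p s * (xl s - x k s) + q s * (yl s - y k s));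
    last by ring.
  apply: combination_bound => //.
    by apply: le_trans (HK1 s sX) _; rewrite /K; lra.
  by apply: le_trans (HK2 s sX) _; rewrite /K; lra.
have H2 : `|wl t - w k.+1 t| <= C' / 2 ^+ k.
  apply: le_trans (HC' _ _ tX) _;
    rewrite ler_wpM2l// lef_pV2 ?posrE ?exprn_gt0//.
  by rewrite ler_weXn2l ?ler1n.
rewrite addr0 (_ : F t - wl t = (F t - w k.+1 t) - (wl t - w k.+1 t));
  last by ring.
apply: le_trans (ler_normB _ _) _; apply: le_trans (lerD H1 H2) _;
  apply: le_trans Hk.
by rewrite le_eqVlt; apply/orP; left; apply/eqP; ring.
Qed.

Lemma linear_system_exists : exists phi psi,
  [/\ scalar_solution t0 a b c d phi psi, phi t0 = x0 & psi t0 = y0].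
Proof.
have Hx X : exists2 C : R, 0 <= C & forall k t, t0 <= t <= X ->
  `|xl t - x k t| <= C / 2 ^+ k.
  by have [C C0 HC] := picard_lim X; exists C => // k t /(HC k)[].
have Hy X : exists2 C : R, 0 <= C & forall k t, t0 <= t <= X ->
  `|yl t - y k t| <= C / 2 ^+ k.
  by have [C C0 HC] := picard_lim X; exists C => // k t /(HC k)[].
have cx : {within half, continuous xl}.
  apply: (uniform_lim_cont (u := x)) => [k|X]; first by
    have [] := picard_cont k.
  by have [C _ HC] := Hx X; exists C.
have cy : {within half, continuous yl}.
  apply: (uniform_lim_cont (u := y)) => [k|X]; first by
    have [] := picard_cont k.
  by have [C _ HC] := Hy X; exists C.
have [] := picard_fixpoint (z0 := x0) ca cb _ _ Hx cx cy.
- by move=> k; have [] := picardS k.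
- by move=> k; have [] := picardS k.
move=> xl0 Dx; have [] := picard_fixpoint (z0 := y0) cc cd _ _ Hy cx cy.
- by move=> k; have [] := picardS k.
- by move=> k; have [] := picardS k.
by move=> yl0 Dy; exists xl, yl.
Qed.

End LinearSystem.

(** * From a scalar Riccati inequality to a nonvanishing solution *)

Section Riccati.
Variables (R : realType) (t0 : R).
Implicit Types (a b c phi psi z dz : R -> R) (t T : R).

Local Notation half := `[t0, +oo[%classic.

(* The coefficient matrix has trace 0, so the Wronskian of the fundamental
   system at t0 stays equal to 1. *)
Lemma linear_system_exists_at a b c T (x1 y1 : R) : t0 <= T ->
  {within half, continuous a} -> {within half, continuous b} ->
  {within half, continuous c} ->
  exists phi psi,
  [/\ scalar_solution t0 a b c (fun t => - a t) phi psi, phi T = x1 &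
      psi T = y1].
Proof.
move=> t0T ca cb cc; have cd := cont_onN ca.
have [f1 [g1 [[Df1 Dg1] f10 g10]]] := linear_system_exists 1 0 ca cb cc cd.
have [f2 [g2 [[Df2 Dg2] f20 g20]]] := linear_system_exists 0 1 ca cb cc cd.
have W1 : f1 T * g2 T - f2 T * g1 T = 1.
  have DW := deriv_onB (deriv_onM Df1 Dg2) (deriv_onM Df2 Dg1).
  have D0 : deriv_on t0 (fun t => f1 t * g2 t - f2 t * g1 t) (fun=> 0).
    by apply: (deriv_on_eq _ _ DW) => // t _; ring.
  by rewrite (deriv_on_eq0_cst D0 t0T) f10 f20 g10 g20; ring.
(* Cramer's rule for the fundamental matrix at [T], whose determinant is 1. *)
pose al := x1 * g2 T - y1 * f2 T; pose be := y1 * f1 T - x1 * g1 T.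
exists (fun t => al * f1 t + be * f2 t), (fun t => al * g1 t + be * g2 t);
  split.
- split.
    have D := deriv_onD (deriv_onM (deriv_on_cst al) Df1)
      (deriv_onM (deriv_on_cst be) Df2).
    by apply: (deriv_on_eq _ _ D) => // t _; ring.
  have D := deriv_onD (deriv_onM (deriv_on_cst al) Dg1)
    (deriv_onM (deriv_on_cst be) Dg2).
  by apply: (deriv_on_eq _ _ D) => // t _; ring.
- rewrite -[RHS]mulr1 -W1 /al /be; ring.
- rewrite -[RHS]mulr1 -W1 /al /be; ring.
Qed.

(* With [w = psi - z phi], the derivative of [phi w] is
   [p w^2 - (z' + p z^2 + 2 sg z + q) phi^2 >= 0], so [phi w >= 0]; then
   [(E phi)^2] is nondecreasing for [E' = - (sg + p z) E]. *)
Lemma riccati_inequality_nonvanishing (sg p q z dz : R -> R) T : t0 <= T ->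
  {within half, continuous sg} -> {within half, continuous p} ->
  {within half, continuous q} -> (forall t, t0 <= t -> 0 <= p t) ->
  deriv_on T z dz ->
  (forall t, T <= t -> dz t + p t * z t ^+ 2 + 2 * sg t * z t + q t <= 0) ->
  exists phi psi,
    scalar_solution t0 sg p (fun t => - q t) (fun t => - sg t) phi psi /\
    forall t, T <= t -> phi t != 0.
Proof.
move=> t0T csg cp cq p0 Dz Hz.
have [phi [psi [sol phiT psiT]]] :=
  linear_system_exists_at 1 (z T) t0T csg cp (cont_onN cq).
exists phi, psi; split => // t Tt.
have [/(deriv_onW t0T) Dphi /(deriv_onW t0T) Dpsi] := sol.
pose r t := sg t + p t * z t.
have cr : {within `[T, +oo[, continuous (fun t => - r t)}.
  apply: cont_onN; apply: cont_onD; first exact: cont_onW csg.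
  by apply: cont_onM; [exact: cont_onW cp|exact: deriv_on_cont Dz].
have c0 := @cont_on_cst R T 0.
(* The scalar equation E' = - r E is solved as a planar system whose other three coefficients are
   0. *)
have [E [E2 [[DE _] ET _]]] := linear_system_exists 1 0 cr c0 c0 c0.
have Dw := deriv_onB (deriv_onM Dphi Dpsi) (deriv_onM Dz (deriv_onM Dphi Dphi)).
have w0 s : T <= s -> 0 <= phi s * psi s - z s * (phi s * phi s).
  move=> Ts; have := deriv_on_ge0_nd Dw _ (lexx T) Ts.
  rewrite phiT psiT !mul1r mulr1 subrr; apply => u Tu.
  have p0u := p0 u (le_trans t0T Tu).
  rewrite (_ : _ - _ = p u * (psi u - z u * phi u) ^+ 2
     + - (dz u + p u * z u ^+ 2 + 2 * sg u * z u + q u) * phi u ^+ 2);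
       last by ring.
  by apply: addr_ge0; apply: mulr_ge0; rewrite ?sqr_ge0 ?oppr_ge0 ?Hz.
have Dv := deriv_onM (deriv_onM DE Dphi) (deriv_onM DE Dphi).
have : 1 <= E t * phi t * (E t * phi t).
  have := deriv_on_ge0_nd Dv _ (lexx T) Tt; rewrite ET phiT !mulr1; apply =>
    u Tu.
  rewrite (_ : _ + _ =
    2 * E u ^+ 2 * p u * (phi u * psi u - z u * (phi u * phi u))).
    have p0u := p0 u (le_trans t0T Tu).
    by apply: mulr_ge0; [apply: mulr_ge0;
      rewrite // mulr_ge0 ?sqr_ge0|exact: w0].
  by rewrite /r; ring.
by apply: contraTneq => ->; rewrite mulr0 mulr0 -ltNge ltr01.
Qed.

End Riccati.

(** * Spectral estimates for hermitian and normal matrices *)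

Section HermitianMatrices.
Variable R : realType.
Local Notation C := (R[i]).

Lemma trmxC_mul m n p (A : 'M[C]_(m, n)) (B : 'M[C]_(n, p)) :
  (A *m B)^t* = B^t* *m A^t*.
Proof. by rewrite trmx_mul map_mxM. Qed.

(** Row vectors are used because [eigenvalue] refers to left eigenvectors. For hermitian [H] the
    form is real, so taking the real part loses nothing. *)
Definition qform n (H : 'M[C]_n) (v : 'rV[C]_n) : R :=
  complex.Re ((v *m H *m v^t*) 0 0).

Definition sqnorm n (v : 'rV[C]_n) : R :=
  \sum_i (complex.Re (v 0 i) ^+ 2 + complex.Im (v 0 i) ^+ 2).

Lemma qform_diag n (d : 'I_n -> R) (v : 'rV[C]_n) :
  qform (diag_mx (\row_i (d i)%:C)) v =
  \sum_i d i * (complex.Re (v 0 i) ^+ 2 + complex.Im (v 0 i) ^+ 2).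
Proof.
rewrite /qform mul_mx_diag !mxE raddf_sum; apply: eq_bigr => i _ /=.
by rewrite !mxE; case: (v 0 i) => x y /=; ring.
Qed.

Lemma qform1 n (v : 'rV[C]_n) : qform 1%:M v = sqnorm v.
Proof.
rewrite -diag_const_mx (_ : const_mx 1 = \row_i (1 : R)%:C);
  last by apply/matrixP => i j; rewrite !mxE.
by rewrite qform_diag; apply: eq_bigr => i _; rewrite mul1r.
Qed.

Lemma qform_unitary n (P H : 'M[C]_n) (v : 'rV[C]_n) :
  qform (P^t* *m H *m P) v = qform H (v *m P^t*).
Proof. by rewrite /qform trmxC_mul trmxCK !mulmxA. Qed.

Lemma sqnorm_unitary n (P : 'M[C]_n) (v : 'rV[C]_n) : P \is unitarymx ->
  sqnorm (v *m P^t*) = sqnorm v.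
Proof.
move=> PU; rewrite -!qform1 -qform_unitary mulmx1.
by congr qform; have /unitarymxP/mulmx1C := PU.
Qed.

Lemma sqnorm_ge0 n (v : 'rV[C]_n) : 0 <= sqnorm v.
Proof. by apply: sumr_ge0 => i _; rewrite addr_ge0 ?sqr_ge0. Qed.

Lemma sqnorm_gt0 n (v : 'rV[C]_n) : v != 0 -> 0 < sqnorm v.
Proof.
move=> v0; rewrite lt0r sqnorm_ge0 andbT; apply: contra v0.
rewrite psumr_eq0 => [/allP H|i _]; last by rewrite addr_ge0 ?sqr_ge0.
apply/eqP/matrixP => i j; rewrite ord1 mxE.
have := H j; rewrite mem_index_enum => /(_ isT) /=.
rewrite paddr_eq0 ?sqr_ge0// !sqrf_eq0 => /andP[/eqP r0 /eqP i0].
by apply/eqP; rewrite eq_complex r0 i0 !eqxx.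
Qed.

Lemma unitary_diag_row n (P : 'M[C]_n) (d : 'rV[C]_n) i : P \is unitarymx ->
  row i P *m (P^t* *m diag_mx d *m P) = d 0 i *: row i P.
Proof.
move=> /unitarymxP PU; rewrite -row_mul !mulmxA PU mul1mx mul_diag_mx.
by apply/rowP => j; rewrite !mxE.
Qed.

Lemma unitary_diag_eigenvalue n (P : 'M[C]_n) (d : 'rV[C]_n) i :
  P \is unitarymx ->
  eigenvalue (P^t* *m diag_mx d *m P) (d 0 i).
Proof.
move=> /unitarymxP PU; apply/eigenvalueP; exists (row i P).
  exact/unitary_diag_row/unitarymxP.
apply/eqP => Pi0; have := congr1 (fun A => row i A) PU.
rewrite row_mul Pi0 mul0mx => /rowP/(_ i); rewrite !mxE eqxx => /eqP.
by rewrite eq_sym oner_eq0.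
Qed.

Lemma hermitian_diag n (H : 'M[C]_n) : H = H^t* ->
  exists P (d : 'I_n -> R), P \is unitarymx /\
    H = P^t* *m diag_mx (\row_i (d i)%:C) *m P.
Proof.
move=> HH; have herm : H \is hermsymmx.
  by apply/is_hermitianmxP; rewrite expr0 scale1r.
exists (spectralmx H), (fun i => complex.Re (spectral_diag H 0 i)).
split; first exact: spectral_unitarymx.
have /orthomx_spectralP := hermitian_normalmx herm.
rewrite invmx_unitary ?spectral_unitarymx// => HE; rewrite [LHS]HE.
congr (_ *m diag_mx _ *m _).
apply/rowP => i; rewrite !mxE RRe_real//.
exact: (mxOverP (hermitian_spectral_diag_real herm)).
Qed.

(** Rayleigh principle: in a unitary eigenbasis the form is the sum of the d_i |v_i|^2, bounded
    below by the smallest d_i times the squared norm, with equality at the matching row of [P].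
    Testing the bound on eigenvectors shows that this d_i is the infimum in [least_eigenvalue]. *)
Lemma least_eigenvalueP n (H : 'M[C]_n) : (0 < n)%N -> H = H^t* ->
  (forall v, least_eigenvalue H * sqnorm v <= qform H v) /\
  exists2 v, sqnorm v = 1 & qform H v = least_eigenvalue H.
Proof.
case: n H => // n H _ /hermitian_diag[P [d [PU HE]]].
pose i0 := [arg min_(i < ord0) d i]%O.
have dmin i : d i0 <= d i by rewrite /i0; case: arg_minP => // j _; apply.
have ray v : d i0 * sqnorm v <= qform H v.
  rewrite HE qform_unitary qform_diag -(sqnorm_unitary v PU) mulr_sumr.
  by apply: ler_sum => i _; rewrite ler_wpM2r// addr_ge0 ?sqr_ge0.
have ei : eigenvalue H (d i0)%:C.
  by have := unitary_diag_eigenvalue (\row_i (d i)%:C) i0 PU; rewrite -HE mxE.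
have qE v (x : R) : v *m H = x%:C *: v -> qform H v = x * sqnorm v.
  move=> vH; rewrite /qform vH -scalemxAl mxE -qform1 /qform mulmx1.
  by case: ((v *m _) 0 0) => a b /=; ring.
have -> : least_eigenvalue H = d i0.
  have lb : lbound [set x : R | eigenvalue H x%:C] (d i0).
    move=> x /= /eigenvalueP[v vH v0]; have := ray v; rewrite (qE _ _ vH).
    by rewrite ler_pM2r// sqnorm_gt0.
  apply/eqP; rewrite eq_le; apply/andP; split.
    by apply: ge_inf => //; exists (d i0).
  by apply: lb_le_inf => //; exists (d i0).
split=> //.
have P1 : sqnorm (row i0 P) = 1.
  have -> : row i0 P = delta_mx 0 i0 *m P by rewrite rowE.
  rewrite -(sqnorm_unitary _ PU) -mulmxA (unitarymxP PU) mulmx1 /sqnorm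
    (bigD1 i0)//= big1.
    by rewrite !mxE !eqxx /=; ring.
  by move=> j ji; rewrite mxE eqxx (negbTE ji) /=; ring.
exists (row i0 P) => //; rewrite -[RHS]mulr1 -P1; apply: qE.
by rewrite [in LHS]HE unitary_diag_row// mxE.
Qed.

Lemma least_eigenvalue_ge0 n (H : 'M[C]_n) : (0 < n)%N -> H = H^t* ->
  nonneg_definite H -> 0 <= least_eigenvalue H.
Proof.
move=> n0 HH Hpos; have [_ [v _ <-]] := least_eigenvalueP n0 HH.
by have := Hpos (v^t*); rewrite trmxCK lecE => /andP[].
Qed.

(** The entrywise l1 distance is built from the very functions whose continuity [mx_continuous_on]
    asserts. *)
Definition mxdist1 n (H K : 'M[C]_n) : R := \sum_i \sum_j
  (`|complex.Re (H i j) - complex.Re (K i j)| + `|complex.Im (H i j) -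
    complex.Im (K i j)|).

Lemma normc_real (x : R) : `|x%:C| = `|x|%:C.
Proof. by rewrite normc_def /= expr0n addr0 sqrtr_sqr. Qed.

Lemma normci : `|'i| = 1 :> C.
Proof. by rewrite normc_def /= expr0n expr1n add0r sqrtr1. Qed.

Lemma mxdist1C n (H K : 'M[C]_n) : mxdist1 H K = mxdist1 K H.
Proof. by apply: eq_bigr => i _; apply: eq_bigr => j _;
  rewrite distrC [X in _ + X]distrC. Qed.

(** The coordinates of a unit vector have modulus at most 1, so the form of K - H is at most the sum
    of the moduli of its entries. *)
Lemma qform_dist n (H K : 'M[C]_n) v : sqnorm v = 1 ->
  qform K v <= qform H v + mxdist1 H K.
Proof.
move=> v1; have vle i : `|v 0 i| <= 1.
  rewrite -(@ler_pXn2r _ 2) ?nnegrE// expr1n -add_Re2_Im2 lecR -v1.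
  rewrite /sqnorm (bigD1 i)//= lerDl sumr_ge0// => j _.
  by rewrite addr_ge0 ?sqr_ge0.
have -> : qform K v = qform H v + qform (K - H) v.
  rewrite /qform mulmxBr mulmxBl.
  have -> (A B : 'M[C]_1) : (A - B) 0 0 = A 0 0 - B 0 0 by rewrite !mxE.
  by rewrite raddfB /= addrC subrK.
rewrite lerD2l mxdist1C -lecR;
  apply: le_trans (_ : `|(v *m (K - H) *m v^t*) 0 0| <= _).
  apply: le_trans (normc_ge_Re _); by rewrite lecR ler_norm.
rewrite mxE /mxdist1 exchange_big /= rmorph_sum;
  apply: le_trans (ler_norm_sum _ _ _) _; apply: ler_sum => j _.
rewrite mxE normrM !mxE norm_conjC rmorph_sum /=;
  apply: le_trans (ler_piMr _ (vle j)) _ => //.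
apply: le_trans (ler_norm_sum _ _ _) _; apply: ler_sum => i _.
rewrite normrM; apply: le_trans (ler_piMl _ (vle i)) _ => //.
rewrite !mxE [X in `|X|]complexE; apply: le_trans (ler_normD _ _) _.
rewrite normrM normci mul1r !normc_real -rmorphD lecR.
by case: (K i j) => a b; case: (H i j).
Qed.

(** A unit minimiser for one matrix serves as a test vector for the other. *)
Lemma least_eigenvalue_dist n (H K : 'M[C]_n) : (0 < n)%N -> H = H^t* ->
  K = K^t* ->
  `|least_eigenvalue H - least_eigenvalue K| <= mxdist1 H K.
Proof.
move=> n0 HH KK.
have le (A B : 'M[C]_n) : A = A^t* -> B = B^t* ->
  least_eigenvalue B - least_eigenvalue A <= mxdist1 A B.
  move=> AA BB; have [_ [v v1 <-]] := least_eigenvalueP n0 AA.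
  have [/(_ v)] := least_eigenvalueP n0 BB; rewrite v1 mulr1 => H1 _.
  by rewrite lerBlDl; apply: le_trans H1 _; exact: qform_dist.
rewrite ler_norml lerNl opprB; apply/andP; split; first exact: le.
by rewrite mxdist1C; exact: le.
Qed.

(** As Z is hermitian, tr (Z B Z) is the sum of the forms of [B] at the rows of Z, to which the
    Rayleigh bound applies. In the squared norms of the rows only the real parts of the diagonal
    entries are kept. *)
Lemma trace_qform_ge n (B Z : 'M[C]_n) : (0 < n)%N -> B = B^t* -> Z = Z^t* ->
  nonneg_definite B ->
  least_eigenvalue B / n%:R * complex.Re (\tr Z) ^+ 2 <=
    complex.Re (\tr (Z *m B *m Z)).
Proof.
move=> n0 BB ZZ Bpos; have l0 := least_eigenvalue_ge0 n0 BB Bpos.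
have [ray _] := least_eigenvalueP n0 BB.
have -> : complex.Re (\tr (Z *m B *m Z)) = \sum_i qform B (row i Z).
  rewrite {2}ZZ /mxtrace raddf_sum; apply: eq_bigr => i _; congr complex.Re.
  rewrite !mxE; apply: eq_bigr => j _; rewrite !mxE; congr (_ * _).
  by apply: eq_bigr => k _; rewrite !mxE.
apply: le_trans (_ : least_eigenvalue B * \sum_i sqnorm (row i Z) <= _);
  last first.
  by rewrite mulr_sumr; apply: ler_sum => i _.
rewrite -mulrA ler_wpM2l//.
pose z i := complex.Re (Z i i).
apply: le_trans (_ : \sum_i z i ^+ 2 <= _); last first.
  apply: ler_sum => i _; rewrite /sqnorm (bigD1 i)//= !mxE -/(z i) -addrA lerDl.
  by rewrite addr_ge0 ?sqr_ge0// sumr_ge0// => j _; rewrite addr_ge0 ?sqr_ge0.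
have -> : complex.Re (\tr Z) = \sum_i z i by rewrite raddf_sum.
have nR : n%:R != 0 :> R by rewrite pnatr_eq0 -lt0n.
set m := \sum_j z j.
(* Cauchy-Schwarz for the diagonal, in the form that its variance is nonnegative. *)
have : 0 <= \sum_i (z i - m / n%:R) ^+ 2 by apply: sumr_ge0 => i _;
  exact: sqr_ge0.
have -> : \sum_i (z i - m / n%:R) ^+ 2 = \sum_i z i ^+ 2 - n%:R^-1 * m ^+ 2.
  rewrite (eq_bigr (fun i =>
    z i ^+ 2 - 2 * (m / n%:R) * z i + (m / n%:R) ^+ 2)); last first.
    by move=> i _; ring.
  rewrite big_split sumrB /= -mulr_sumr -/m sumr_const card_ord -mulr_natr.
  by field; exact: nR.
by rewrite subr_ge0.
Qed.

(** A normal matrix is unitarily diagonal, and its adjoint has the conjugate diagonal in the same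
    basis; the diagonal of the sum consists of the doubled real parts, all equal here. *)
Lemma OmegaP n (M : 'M[C]_n) : (0 < n)%N -> Omega M ->
  M + M^t* = (2 * W M)%:C%:M.
Proof.
move=> n0 [Mn Mre].
have WE a : eigenvalue M a -> complex.Re a = W M.
  move=> Ma; rewrite /W; case: xgetP => [x _ [b /= Mb <-]|/(_ (complex.Re a))].
    exact: Mre.
  by case; exists a.
have /orthomx_spectralP ME := Mn; have PU := spectral_unitarymx M.
set P := spectralmx M in ME PU; set d := spectral_diag M in ME.
rewrite invmx_unitary// in ME.
have dW i : complex.Re (d 0 i) = W M by apply: WE; rewrite ME;
  exact: unitary_diag_eigenvalue.
rewrite [in LHS]ME !trmxC_mul trmxCK mulmxA -mulmxDl -mulmxDr.
have -> : diag_mx d + (diag_mx d)^t* = (2 * W M)%:C%:M.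
  apply/matrixP => i j; rewrite !mxE eq_sym; case: eqVneq => [->|_];
    last by rewrite !mulr0n conjC0 addr0.
  by rewrite !mulr1n -(dW i); case: (d 0 i) => a b; apply/eqP;
    rewrite eq_complex /=; apply/andP; split; apply/eqP; ring.
rewrite mul_mx_scalar -scalemxAl; have /unitarymxP/mulmx1C -> := PU.
by rewrite scalemx1.
Qed.

(** The trace formula makes the continuity of [sigma] visible, which the choice in [W] hides. *)
Lemma Omega_W n (M : 'M[C]_n) : (0 < n)%N -> Omega M ->
  W M = complex.Re (\tr M) / n%:R.
Proof.
move=> n0 MO; have nR : n%:R != 0 :> R by rewrite pnatr_eq0 -lt0n.
have := congr1 (fun A => complex.Re (\tr A)) (OmegaP n0 MO).
rewrite mxtrace_scalar mxtraceD raddfD /=.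
have -> : complex.Re (\tr (M^t*)) = complex.Re (\tr M).
  by rewrite /mxtrace !raddf_sum; apply: eq_bigr => i _; rewrite !mxE;
    case: (M i i).
rewrite raddfMn /= -mulr_natr => H.
by apply: (mulIf nR); rewrite divfK//; lra.
Qed.

End HermitianMatrices.

(** * Calculus for complex-valued and matrix-valued functions *)

Section ComplexCalculus.
Variables (R : realType) (t0 : R).
Local Notation C := (R[i]).
Local Notation half := `[t0, +oo[%classic.
Implicit Types (f g df dg : R -> C).

(** This and [cderiv_on] are convertible to the entrywise clauses of [mx_continuous_on] and
    [mx_deriv_on], so matrix hypotheses apply to entries directly. *)
Definition ccont_on f : Prop :=
  {within half, continuous (fun t => complex.Re (f t))} /\
  {within half, continuous (fun t => complex.Im (f t))}.

Definition cderiv_on f df : Prop :=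
  deriv_on t0 (fun t => complex.Re (f t)) (fun t => complex.Re (df t)) /\
  deriv_on t0 (fun t => complex.Im (f t)) (fun t => complex.Im (df t)).

Lemma ccont_on_eq f g : (forall t, t0 <= t -> f t = g t) -> ccont_on f ->
  ccont_on g.
Proof. by move=> fg [f1 f2]; split;
  [apply: cont_on_eq f1|apply: cont_on_eq f2] => t /fg ->. Qed.

Lemma ccont_on_cst c : ccont_on (fun=> c).
Proof. by split; exact: cont_on_cst. Qed.

Lemma ccont_onD f g : ccont_on f -> ccont_on g -> ccont_on (fun t => f t + g t).
Proof.
move=> [f1 f2] [g1 g2]; split.
  by apply: cont_on_eq (cont_onD f1 g1) => t _; case: (f t); case: (g t).
by apply: cont_on_eq (cont_onD f2 g2) => t _; case: (f t); case: (g t).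
Qed.

Lemma ccont_onN f : ccont_on f -> ccont_on (fun t => - f t).
Proof.
move=> [f1 f2]; split.
  by apply: cont_on_eq (cont_onN f1) => t _; case: (f t).
by apply: cont_on_eq (cont_onN f2) => t _; case: (f t).
Qed.

Lemma ccont_onM f g : ccont_on f -> ccont_on g -> ccont_on (fun t => f t * g t).
Proof.
move=> [f1 f2] [g1 g2]; split.
  by apply: cont_on_eq (cont_onB (cont_onM f1 g1) (cont_onM f2 g2)) => t _;
    case: (f t); case: (g t).
by apply: cont_on_eq (cont_onD (cont_onM f1 g2) (cont_onM f2 g1)) => t _;
  case: (f t); case: (g t).
Qed.

Lemma ccont_on_conj f : ccont_on f -> ccont_on (fun t => (f t)^*).
Proof.
move=> [f1 f2]; split; first by apply: cont_on_eq f1 => t _; case: (f t).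
by apply: cont_on_eq (cont_onN f2) => t _; case: (f t).
Qed.

Lemma ccont_on_sum (I : Type) (r : seq I) (F : I -> R -> C) :
  (forall i, ccont_on (F i)) -> ccont_on (fun t => \sum_(i <- r) F i t).
Proof.
move=> cF; elim: r => [|i r IHr].
  by apply: ccont_on_eq (ccont_on_cst 0) => t _; rewrite big_nil.
by apply: ccont_on_eq (ccont_onD (cF i) IHr) => t _; rewrite big_cons.
Qed.

Lemma mx_cont_on_mul n (M N : R -> 'M[C]_n) : mx_continuous_on t0 M ->
  mx_continuous_on t0 N -> mx_continuous_on t0 (fun t => M t *m N t).
Proof.
move=> cM cN i j; suff : ccont_on (fun t => \sum_k M t i k * N t k j).
  by apply: ccont_on_eq => t _; rewrite mxE.
by apply: ccont_on_sum => k; apply: ccont_onM; [exact: cM|exact: cN].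
Qed.

Lemma mx_cont_on_add n (M N : R -> 'M[C]_n) : mx_continuous_on t0 M ->
  mx_continuous_on t0 N -> mx_continuous_on t0 (fun t => M t + N t).
Proof.
move=> cM cN i j; suff : ccont_on (fun t => M t i j + N t i j).
  by apply: ccont_on_eq => t _; rewrite mxE.
by apply: ccont_onD; [exact: cM|exact: cN].
Qed.

Lemma mx_cont_on_opp n (M : R -> 'M[C]_n) : mx_continuous_on t0 M ->
  mx_continuous_on t0 (fun t => - M t).
Proof.
move=> cM i j; suff : ccont_on (fun t => - M t i j).
  by apply: ccont_on_eq => t _; rewrite mxE.
by apply: ccont_onN; exact: cM.
Qed.

Lemma mx_cont_on_trmxC n (M : R -> 'M[C]_n) : mx_continuous_on t0 M ->
  mx_continuous_on t0 (fun t => (M t)^t*).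
Proof.
move=> cM i j; suff : ccont_on (fun t => (M t j i)^*).
  by apply: ccont_on_eq => t _; rewrite !mxE.
by apply: ccont_on_conj; exact: cM.
Qed.

Lemma Re_trace_cont_on n (M : R -> 'M[C]_n) : mx_continuous_on t0 M ->
  {within half, continuous (fun t => complex.Re (\tr (M t)))}.
Proof. by move=> cM; have [] :=
  ccont_on_sum (index_enum 'I_n) (fun i => cM i i). Qed.

Lemma least_eigenvalue_cont_on n (B : R -> 'M[C]_n) : (0 < n)%N ->
  mx_continuous_on t0 B -> (forall t, t0 <= t -> B t = (B t)^t*) ->
  {within half, continuous (fun t => least_eigenvalue (B t))}.
Proof.
move=> n0 cB hB; apply/cont_onP => t t0t.
(* The distance to the fixed matrix [B t] is continuous in [s] and vanishes at s = t; it dominates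
   the variation of the least eigenvalue. *)
have cm : {within half, continuous (fun s => mxdist1 (B t) (B s))}.
  apply: cont_on_sum => i; apply: cont_on_sum => j; have [cR cI] := cB i j.
  by apply: cont_onD; apply/cont_onP => s t0s; apply: cvg_norm; apply: cvgB;
    (exact: cvg_cst || exact: (cont_onP _ _).1).
apply/cvgrPdist_le => e e0.
have /cont_onP/(_ t t0t)/cvgrPdist_le/(_ _ e0) := cm.
rewrite !near_withinE => H; near=> s => sh.
have t0s : t0 <= s by move: sh; rewrite /= in_itv /= andbT.
apply: le_trans (least_eigenvalue_dist n0 (hB t t0t) (hB s t0s)) _.
have : `|mxdist1 (B t) (B t) - mxdist1 (B t) (B s)| <= e.
  by move: sh; near: s; exact: H.
rewrite {1}/mxdist1 big1 => [|i _]; last by rewrite big1// => j _;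
  rewrite !subrr normr0 addr0.
rewrite sub0r normrN; apply: le_trans; exact: ler_norm.
Unshelve. all: by end_near. Qed.

Lemma cderiv_on_eq f g df dg : (forall t, t0 <= t -> f t = g t) ->
  (forall t, t0 <= t -> df t = dg t) -> cderiv_on f df -> cderiv_on g dg.
Proof.
move=> fg dfg [f1 f2]; split.
  by apply: (deriv_on_eq _ _ f1) => t t0t; rewrite ?fg ?dfg.
by apply: (deriv_on_eq _ _ f2) => t t0t; rewrite ?fg ?dfg.
Qed.

Lemma cderiv_on_cst c : cderiv_on (fun=> c) (fun=> 0).
Proof. by split; exact: deriv_on_cst. Qed.

Lemma cderiv_onD f g df dg : cderiv_on f df -> cderiv_on g dg ->
  cderiv_on (fun t => f t + g t) (fun t => df t + dg t).
Proof.
move=> [f1 f2] [g1 g2]; split.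
  by apply: (deriv_on_eq _ _ (deriv_onD f1 g1)) => t _; rewrite raddfD.
by apply: (deriv_on_eq _ _ (deriv_onD f2 g2)) => t _; rewrite raddfD.
Qed.

Lemma cderiv_onN f df : cderiv_on f df ->
  cderiv_on (fun t => - f t) (fun t => - df t).
Proof.
move=> [f1 f2]; split.
  by apply: (deriv_on_eq _ _ (deriv_onN f1)) => t _; rewrite raddfN.
by apply: (deriv_on_eq _ _ (deriv_onN f2)) => t _; rewrite raddfN.
Qed.

Lemma cderiv_onM f g df dg : cderiv_on f df -> cderiv_on g dg ->
  cderiv_on (fun t => f t * g t) (fun t => df t * g t + f t * dg t).
Proof.
move=> [f1 f2] [g1 g2]; split.
  apply: (deriv_on_eq _ _ (deriv_onB (deriv_onM f1 g1) (deriv_onM f2 g2))) =>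
    t _.
    by case: (f t); case: (g t).
  by case: (f t); case: (g t); case: (df t); case: (dg t) => * /=; ring.
apply: (deriv_on_eq _ _ (deriv_onD (deriv_onM f1 g2) (deriv_onM f2 g1))) => t _.
  by case: (f t); case: (g t).
by case: (f t); case: (g t); case: (df t); case: (dg t) => * /=; ring.
Qed.

Lemma cderiv_on_uniq f df dg : cderiv_on f df -> cderiv_on f dg ->
  forall t, t0 <= t -> df t = dg t.
Proof.
move=> [r1 i1] [r2 i2] t t0t; apply/eqP; rewrite eq_complex.
by rewrite (deriv_on_uniq r1 r2)// (deriv_on_uniq i1 i2)// !eqxx.
Qed.

(** Differentiability without a formula suffices for determinants and cofactors; the derivative of
    the inverse matrix is identified afterwards. *)
Definition cdifferentiable_on f : Prop := exists df, cderiv_on f df.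

Lemma cdifferentiable_onD f g : cdifferentiable_on f -> cdifferentiable_on g ->
  cdifferentiable_on (fun t => f t + g t).
Proof. by move=> [df Df] [dg Dg]; eexists; exact: cderiv_onD Df Dg. Qed.

Lemma cdifferentiable_onM f g : cdifferentiable_on f -> cdifferentiable_on g ->
  cdifferentiable_on (fun t => f t * g t).
Proof. by move=> [df Df] [dg Dg]; eexists; exact: cderiv_onM Df Dg. Qed.

Lemma cdifferentiable_on_cst c : cdifferentiable_on (fun=> c).
Proof. by eexists; exact: cderiv_on_cst. Qed.

Lemma cdifferentiable_on_eq f g : (forall t, t0 <= t -> f t = g t) ->
  cdifferentiable_on f -> cdifferentiable_on g.
Proof. by move=> fg [df Df]; exists df; exact: (cderiv_on_eq fg _ Df). Qed.

Lemma cdifferentiable_on_sum (I : Type) (r : seq I) (F : I -> R -> C) :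
  (forall i, cdifferentiable_on (F i)) ->
  cdifferentiable_on (fun t => \sum_(i <- r) F i t).
Proof.
move=> dF; elim: r => [|i r IHr].
  by apply: (cdifferentiable_on_eq _ (cdifferentiable_on_cst 0)) => t _;
    rewrite big_nil.
by apply: (cdifferentiable_on_eq _ (cdifferentiable_onD (dF i) IHr)) => t _;
  rewrite big_cons.
Qed.

Lemma cdifferentiable_on_prod (I : Type) (r : seq I) (F : I -> R -> C) :
  (forall i, cdifferentiable_on (F i)) ->
  cdifferentiable_on (fun t => \prod_(i <- r) F i t).
Proof.
move=> dF; elim: r => [|i r IHr].
  by apply: (cdifferentiable_on_eq _ (cdifferentiable_on_cst 1)) => t _;
    rewrite big_nil.
by apply: (cdifferentiable_on_eq _ (cdifferentiable_onM (dF i) IHr)) => t _;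
  rewrite big_cons.
Qed.

(** The inverse is the conjugate divided by the squared modulus [N], a real function without
    zeros. *)
Lemma cdifferentiable_onV f : (forall t, t0 <= t -> f t != 0) ->
  cdifferentiable_on f -> cdifferentiable_on (fun t => (f t)^-1).
Proof.
move=> f0 [df [D1 D2]].
pose N t := complex.Re (f t) * complex.Re (f t) + complex.Im (f t) * complex.Im
  (f t).
have N0 t : t0 <= t -> N t != 0.
  move=> /f0; apply: contra; rewrite /N -!expr2 paddr_eq0 ?sqr_ge0// !sqrf_eq0.
  by rewrite eq_complex.
have DV := deriv_onV N0 (deriv_onD (deriv_onM D1 D1) (deriv_onM D2 D2)).
have [r Dr] : exists r, deriv_on t0 (fun t => complex.Re (f t) / N t) r.
  by eexists; exact: deriv_onM D1 DV.
have [s Ds] : exists s, deriv_on t0 (fun t => - (complex.Im (f t) / N t)) s.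
  by eexists; exact: deriv_onN (deriv_onM D2 DV).
exists (fun t => Complex (r t) (s t)); split.
  by apply: (deriv_on_eq _ _ Dr) => t _ //; rewrite /N -!expr2; case: (f t).
by apply: (deriv_on_eq _ _ Ds) => t _ //; rewrite /N -!expr2; case: (f t).
Qed.

Lemma cdifferentiable_on_det n (M : R -> 'M[C]_n) :
  (forall i j, cdifferentiable_on (fun t => M t i j)) ->
  cdifferentiable_on (fun t => \det (M t)).
Proof.
move=> dM; apply: cdifferentiable_on_sum => s.
apply: cdifferentiable_onM; first exact: cdifferentiable_on_cst.
exact: cdifferentiable_on_prod.
Qed.

Lemma mx_deriv_on_eq n (M N M' N' : R -> 'M[C]_n) :
  (forall t, t0 <= t -> M t = N t) -> (forall t, t0 <= t -> M' t = N' t) ->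
  mx_deriv_on t0 M M' -> mx_deriv_on t0 N N'.
Proof.
move=> MN MN' DM i j;
  suff : cderiv_on (fun t => N t i j) (fun t => N' t i j) by [].
by apply: cderiv_on_eq (DM i j) => t t0t; rewrite ?MN ?MN'.
Qed.

Lemma mx_deriv_on_mul n (M N M' N' : R -> 'M[C]_n) :
  mx_deriv_on t0 M M' -> mx_deriv_on t0 N N' ->
  mx_deriv_on t0 (fun t => M t *m N t) (fun t => M' t *m N t + M t *m N' t).
Proof.
move=> DM DN i j.
suff : cderiv_on (fun t => \sum_k M t i k * N t k j)
                 (fun t => \sum_k (M' t i k * N t k j + M t i k * N' t k j)).
  by apply: cderiv_on_eq => t _; rewrite !mxE -?big_split.
elim: (index_enum 'I_n) => [|k r IHr].
  by apply: (cderiv_on_eq _ _ (cderiv_on_cst 0)) => t _; rewrite big_nil.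
have Dk := cderiv_onM (DM i k) (DN k j).
by apply: (cderiv_on_eq _ _ (cderiv_onD Dk IHr)) => t _; rewrite big_cons.
Qed.

Lemma mx_deriv_on_sub n (M N M' N' : R -> 'M[C]_n) :
  mx_deriv_on t0 M M' -> mx_deriv_on t0 N N' ->
  mx_deriv_on t0 (fun t => M t - N t) (fun t => M' t - N' t).
Proof.
move=> DM DN i j.
suff : cderiv_on (fun t => M t i j - N t i j) (fun t => M' t i j - N' t i j).
  by apply: cderiv_on_eq => t _; rewrite !mxE.
exact: cderiv_onD (DM i j) (cderiv_onN (DN i j)).
Qed.

Lemma Re_trace_deriv_on n (M M' : R -> 'M[C]_n) : mx_deriv_on t0 M M' ->
  deriv_on t0 (fun t => complex.Re (\tr (M t)))
    (fun t => complex.Re (\tr (M' t))).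
Proof.
move=> DM; have D :=
  @deriv_on_sum R t0 _ (index_enum 'I_n) predT _ _ (fun i => (DM i i).1).
by apply: (deriv_on_eq _ _ D) => t _; rewrite /mxtrace raddf_sum.
Qed.

(** By the adjugate formula, each entry of the inverse is a cofactor divided by the determinant. *)
Lemma mx_differentiable_on_inv n (M M' : R -> 'M[C]_n) :
  (forall t, t0 <= t -> M t \in unitmx) -> mx_deriv_on t0 M M' ->
  exists N', mx_deriv_on t0 (fun t => invmx (M t)) N'.
Proof.
move=> Mu DM.
have dM i j : cdifferentiable_on (fun t => M t i j) by eexists; exact: DM.
have dN i j : cdifferentiable_on (fun t => invmx (M t) i j).
  apply: (@cdifferentiable_on_eq (fun t => (\det (M t))^-1 * \adj (M t) i j)) =>
    [t t0t|].
    by rewrite /invmx Mu// !mxE.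
  apply: cdifferentiable_onM.
    apply: cdifferentiable_onV; last exact: cdifferentiable_on_det.
    by move=> t /Mu; rewrite unitmxE unitfE.
  apply: (@cdifferentiable_on_eq (fun t => cofactor (M t) j i)) => [t _|];
    first by rewrite mxE.
  apply: cdifferentiable_onM; first exact: cdifferentiable_on_cst.
  apply: cdifferentiable_on_det => k l.
  by apply: (cdifferentiable_on_eq _ (dM (lift j k) (lift i l))) => t _;
    rewrite !mxE.
exists (fun t => \matrix_(i, j) sval (cid (dN i j)) t) => i j.
suff : cderiv_on (fun t => invmx (M t) i j) (sval (cid (dN i j))).
  by apply: cderiv_on_eq => t _; rewrite ?mxE.
exact: (svalP (cid (dN i j))).
Qed.

(** The product of M and its inverse is constant, so by uniqueness of derivatives the product rule
    gives 0, which is solved for the unknown derivative. *)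
Lemma mx_deriv_on_inv n (M M' : R -> 'M[C]_n) :
  (forall t, t0 <= t -> M t \in unitmx) -> mx_deriv_on t0 M M' ->
  mx_deriv_on t0 (fun t => invmx (M t))
    (fun t => - (invmx (M t) *m M' t *m invmx (M t))).
Proof.
move=> Mu DM; have [N' DN] := mx_differentiable_on_inv Mu DM.
apply: (mx_deriv_on_eq _ _ DN) => // t t0t.
have : M' t *m invmx (M t) + M t *m N' t = 0.
  apply/matrixP => i j; rewrite [RHS]mxE.
  apply: (cderiv_on_uniq (mx_deriv_on_mul DM DN i j) _ t0t).
  apply: (cderiv_on_eq _ _ (cderiv_on_cst (1%:M i j))) => // s t0s.
  by rewrite mulmxV ?Mu.
move=> /eqP; rewrite addrC addr_eq0 => /eqP MN.
by rewrite -[N' t](mulKmx (Mu t t0t)) MN mulmxN mulmxA.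
Qed.

End ComplexCalculus.

Lemma mx_deriv_onW (R : realType) (t0 T : R) n (M M' : R -> 'M[R[i]]_n) : t0 <=
  T ->
  mx_deriv_on t0 M M' -> mx_deriv_on T M M'.
Proof. by move=> t0T DM i j; have [D1 D2] := DM i j; split;
  exact: deriv_onW t0T _. Qed.

(** * The matrix Riccati equation of a prepared solution *)

Section MatrixRiccati.
Variables (R : realType) (n : nat).
Local Notation C := (R[i]).

(** Completing the square in Y = Z + S: the terms free of Z gather into D_S. [G] stands for the
    coefficient C of the system. *)
Lemma riccati_shift (A A' B G S dS Y : 'M[C]_n) (Z := Y - S) :
  G - A' *m Y - Y *m A - Y *m B *m Y - dS =
  - (Z *m B *m Z + ((A' + S *m B) *m Z + Z *m (A + B *m S)) +
     (dS + S *m B *m S + A' *m S + S *m A - G)).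
Proof.
rewrite {}/Z !(mulmxBl, mulmxBr, mulmxDl, mulmxDr, mulNmx) !mulmxA.
(* After expansion the noncommutative products enter as opaque matrices, so the identity becomes
   linear in their entries. *)
move: (A' *m Y) (Y *m A) (Y *m B *m Y) (S *m B *m S) (A' *m S) (S *m A) =>
  a b c d e f.
move: (Y *m B *m S) (S *m B *m Y) => g h.
by apply/matrixP => i j; rewrite !mxE; ring.
Qed.

(** With N the inverse of Phi, Psi N = N^* (Phi^* Psi) N, and preparedness turns this into N^*
    Psi^*. *)
Lemma prepared_quotient_hermitian (Phi Psi : 'M[C]_n) : Phi \in unitmx ->
  Phi^t* *m Psi = Psi^t* *m Phi ->
  Psi *m invmx Phi = (Psi *m invmx Phi)^t*.
Proof.
move=> Pu prep; rewrite trmxC_mul.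
have NP : (invmx Phi)^t* *m Phi^t* = 1%:M.
  by rewrite -trmxC_mul mulmxV// trmx1 map_mx1.
by rewrite -[Psi in LHS]mul1mx -NP -!mulmxA [Phi^t* *m _]mulmxA prep
  -[Psi^t* *m _ *m _]mulmxA mulmxV// mulmx1.
Qed.

Lemma quotient_deriv (t0 : R) (A B G Phi Psi : R -> 'M[C]_n) :
  (forall t, t0 <= t -> Phi t \in unitmx) ->
  mx_deriv_on t0 Phi (fun t => A t *m Phi t + B t *m Psi t) ->
  mx_deriv_on t0 Psi (fun t => G t *m Phi t - (A t)^t* *m Psi t) ->
  let Y t := Psi t *m invmx (Phi t) in
  mx_deriv_on t0 Y (fun t =>
    G t - (A t)^t* *m Y t - Y t *m A t - Y t *m B t *m Y t).
Proof.
move=> Pu DPhi DPsi Y.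
apply: (mx_deriv_on_eq _ _ (mx_deriv_on_mul DPsi (mx_deriv_on_inv Pu DPhi))) =>
  // t t0t.
rewrite /Y mulmxBl !mulmxDr !mulmxDl -[G t *m _ *m _]mulmxA mulmxV ?Pu// mulmx1.
by rewrite mulmxN mulmxDr !mulmxA mulmxK ?Pu// opprD addrA.
Qed.

End MatrixRiccati.

(* In the scalar system, tr (D_S(t)) is real because D_S(t) is hermitian; its
   real part is taken only to obtain a coefficient of type R. *)
Theorem corollary2p1 (R : realType) (n : nat) (n_gt0 : (0 < n)%N) (t0 : R)
    (A B C : R -> 'M[R[i]]_n)
    (A_cont : mx_continuous_on t0 A)
    (B_cont : mx_continuous_on t0 B)
    (C_cont : mx_continuous_on t0 C)
    (B_herm : forall t, t0 <= t -> B t = (B t)^t*)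
    (C_herm : forall t, t0 <= t -> C t = (C t)^t*)
    (B_ge0 : forall t, t0 <= t -> nonneg_definite (B t))
    (S dS : R -> 'M[R[i]]_n)
    (S_C1 : mx_C1_on t0 S dS)
    (S_herm : forall t, t0 <= t -> S t = (S t)^t*)
    (S_Omega : forall t, t0 <= t -> Omega ((A t)^t* + S t *m B t))
    (scalar_osc : scalar_oscillatory t0
       (sigma A B S)
       (fun t => least_eigenvalue (B t) / n%:R)
       (fun t => - complex.Re (\tr (DS A B C S dS t)))
       (fun t => - sigma A B S t)) :
  hamiltonian_oscillatory t0 A B C.
Proof.
move=> Phi Psi [[DPhi _] [DPsi _]] prep T0; apply: contrapT => noz.
pose T := Num.max t0 T0.
have t0T : t0 <= T by rewrite le_max lexx.
have Pu t : T <= t -> Phi t \in unitmx.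
  rewrite ge_max => /andP[t0t T0t]; rewrite unitmxE unitfE; apply/eqP => d0.
  by apply: noz; exists t.
have [DS' dS_cont] := S_C1.
have S_cont : mx_continuous_on t0 S.
  by move=> i j; have [D1 D2] := DS' i j; split;
    [exact: deriv_on_cont D1|exact: deriv_on_cont D2].
have M_cont : mx_continuous_on t0 (fun t => (A t)^t* + S t *m B t).
  by apply: mx_cont_on_add; [exact: mx_cont_on_trmxC|exact: mx_cont_on_mul].
have D_cont : mx_continuous_on t0 (DS A B C S dS).
  apply: mx_cont_on_add; last exact: mx_cont_on_opp.
  apply: mx_cont_on_add; last exact: mx_cont_on_mul.
  apply: mx_cont_on_add; last by apply: mx_cont_on_mul => //;
    exact: mx_cont_on_trmxC.
  by apply: mx_cont_on_add => //; apply: mx_cont_on_mul => //;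
    exact: mx_cont_on_mul.
have sigma_cont : {within `[t0, +oo[, continuous (sigma A B S)}.
  have cW := cont_onM (Re_trace_cont_on M_cont) (@cont_on_cst R t0 n%:R^-1).
  apply: cont_on_eq cW => t t0t.
  by rewrite /sigma (Omega_W n_gt0 (S_Omega t t0t)).
have lam_cont :
  {within `[t0, +oo[, continuous (fun t => least_eigenvalue (B t) / n%:R)}.
  by apply: cont_onM; [exact: least_eigenvalue_cont_on|exact: cont_on_cst].
pose Y t := Psi t *m invmx (Phi t).
have DY := quotient_deriv Pu (mx_deriv_onW t0T DPhi) (mx_deriv_onW t0T DPsi).
have Dz := Re_trace_deriv_on (mx_deriv_on_sub DY (mx_deriv_onW t0T DS')).
have [||phi [psi [sol phi0]]] :=
  riccati_inequality_nonvanishing t0T sigma_cont lam_cont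
  (Re_trace_cont_on D_cont) _ Dz _.
- move=> t t0t; apply: divr_ge0 => //.
  by apply: least_eigenvalue_ge0 => //; [exact: B_herm|exact: B_ge0].
- move=> t Tt; have t0t := le_trans t0T Tt.
  have YY := prepared_quotient_hermitian (Pu t Tt) (prep t t0t).
  rewrite /= -!/(Y t) (riccati_shift _ _ _ _ (S t)) -/(DS A B C S dS t).
  set Z := Y t - S t; set D := DS A B C S dS t; set M := (A t)^t* + S t *m B t.
  have ZZ : Z = Z^t* by rewrite /Z raddfB map_mxB /= -S_herm// -YY.
  have -> : A t + B t *m S t = M^t*.
    by rewrite /M raddfD map_mxD /= trmxC_mul trmxCK -S_herm// -B_herm.
  (* Cyclicity merges both terms into the trace of (M^* + M) Z; the membership in [Omega] makes the
     first factor scalar. *)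
  have trMZ : \tr (M *m Z + Z *m M^t*) = (2 * sigma A B S t)%:C * \tr Z.
    rewrite mxtraceD [\tr (Z *m _)]mxtrace_mulC -mxtraceD -mulmxDl.
    by rewrite (OmegaP n_gt0 (S_Omega t t0t)) mul_scalar_mx mxtraceZ.
  have ReM (a : R) (z : R[i]) : complex.Re (a%:C * z) = a * complex.Re z.
    by case: z => x y /=; ring.
  rewrite raddfN /= 2!mxtraceD trMZ raddfN /= 2!raddfD /=
    [complex.Re (_ + _)]raddfD /= ReM.
  (* The trace of the Riccati equation expresses z' exactly, so the only loss is in the quadratic
     term. *)
  have := trace_qform_ge n_gt0 (B_herm t t0t) ZZ (B_ge0 t t0t).
  lra.
have [t [_ Tt /eqP]] := scalar_osc phi psi sol T.
by rewrite (negbTE (phi0 t Tt)).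
Qed.
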